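(* Let $N,n,m,p$ be positive integers, $A\in\mathbb R^{n\times n}$, $B\in\mathbb R^{n\times m}$, $C\in\mathbb R^{p\times n}$, $\Sigma=(A,B,C)$. There exists a structured output-feedback gain matrix $\mathcal F\in\mathbb R^{Nm\times Np}$ such that the $N$-periodic closed-loop system $$x(k+1)=Ax(k)+B\sum_{i=0}^{\lceil k\rceil_N}F^{(\lceil k\rceil_N,i)}Cx(k-i),\quad k\in\mathbb N,$$ (equivalently, the LTI system $\phi(t+1)=\mathcal A_{\mathrm{LTI}}(\mathcal F,\Sigma)\phi(t)$, $t\in\mathbb N$, with $\phi(t)=x(Nt)$) is asymptotically stable if and only if there exist $P=P^T\in\mathbb R^{n\times n}$, $M\in\mathbb R^{N(n+m)\times((N-1)n+Nm)}$ and a structured output-feedback gain matrix $\mathcal F\in\mathbb R^{Nm\times Np}$ such that $$P\succ0,\qquad \Pi_N^T\,\mathcal X_N(P,1)\,\Pi_N+\mathrm{He}\{M\,\mathcal C(\mathcal F)\}\prec0 .$$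
   Context: Notation: $\mathbb N$ is the set of nonnegative integers; $\lceil k\rceil_N$ denotes the remainder of $k$ divided by $N$; $\mathrm{He}\{X\}=X^T+X$; $\otimes$ is the Kronecker product; $\mathbf I_q$ is the $q\times q$ identity; $\mathbf 0$ is a zero matrix of appropriate size; $\mathbf e_{(q,i)}\in\mathbb R^q$ is the $i$-th standard unit column vector; $\succ0$ ($\prec0$) means symmetric positive (negative) definite. $\mathcal L_{N-1}=[\mathbf I_{N-1}\ \ \mathbf 0_{N-1}]$ and $\mathcal R_{N-1}=[\mathbf 0_{N-1}\ \ \mathbf I_{N-1}]$, both in $\mathbb R^{(N-1)\times N}$, where $\mathbf 0_{N-1}$ is the zero column vector (for $N=1$ these are empty and the corresponding blocks are absent). Structured output-feedback gain matrix: a block lower triangular matrix collecting gains $F^{(k,i)}\in\mathbb R^{m\times p}$, $0\le i\le k\le N-1$, $$\mathcal F=\begin{bmatrix}F^{(0,0)}&\mathbf 0&\cdots&\mathbf 0\\ F^{(1,1)}&F^{(1,0)}&\ddots&\vdots\\ \vdots&\ddots&\ddots&\mathbf 0\\ F^{(N-1,N-1)}&\cdots&F^{(N-1,1)}&F^{(N-1,0)}\end{bmatrix}\in\mathbb R^{Nm\times Np},$$ corresponding to the periodically time-varying memory static output feedback controller $u(k)=\sum_{i=0}^{\lceil k\rceil_N}F^{(\lceil k\rceil_N,i)}y(k-i)$ for the system $x(k+1)=Ax(k)+Bu(k)$, $y(k)=Cx(k)$. $\mathcal A_{\mathrm{LTI}}(\mathcal F,\Sigma)\in\mathbb R^{n\times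 n}$ is the matrix with $x(k+N)=\mathcal A_{\mathrm{LTI}}(\mathcal F,\Sigma)x(k)$ along the closed-loop system for all $k$ divisible by $N$; explicitly $\mathcal A_{\mathrm{LTI}}(\mathcal F,\Sigma)=\Phi_N$, where $\Phi_0=\mathbf I_n$ and $\Phi_\delta=A\Phi_{\delta-1}+B\sum_{i=0}^{\delta-1}F^{(\delta-1,i)}C\,\Phi_{\delta-1-i}$ for $\delta=1,\dots,N$. Further matrices: $$\mathcal X_N(P,\gamma)=\bigl(-\gamma\,\mathbf e_{(N+1,1)}\mathbf e_{(N+1,1)}^T+\mathbf e_{(N+1,N+1)}\mathbf e_{(N+1,N+1)}^T\bigr)\otimes P,$$ $$\Pi_N=\begin{bmatrix}\mathbf e_{(N,1)}^T\otimes\mathbf I_n&\mathbf 0_{n\times Nm}\\ \mathbf I_N\otimes A&\mathbf I_N\otimes B\end{bmatrix},$$ $$\mathcal C(\mathcal F)=\begin{bmatrix}\mathcal F(\mathbf I_N\otimes C)&-\mathbf I_N\otimes\mathbf I_m\\ \mathcal L_{N-1}\otimes A-\mathcal R_{N-1}\otimes\mathbf I_n&\mathcal L_{N-1}\otimes B\end{bmatrix}.$$ *)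

(* Defs.v *)
From HB Require Import structures.
From mathcomp Require Import all_boot all_order all_algebra.
From mathcomp Require Import mxtens.
From mathcomp Require Import all_classical all_reals all_analysis.

Set Implicit Arguments.
Unset Strict Implicit.
Unset Printing Implicit Defensive.

Import Order.TTheory GRing.Theory Num.Theory.
Import numFieldNormedType.Exports.

Local Open Scope classical_set_scope.
Local Open Scope ring_scope.

(* The Kronecker product is [_ *t _] from mxtens: the entry of
   A *t B at (mxtens_index (i, k), mxtens_index (j, l)) is A i j * B k l, with
   mxtens_index (i, k) = i * p + k when B has p rows. *)

Section Definiteness.
Variables (R : realType) (q : nat).
Implicit Types X : 'M[R]_q.

Definition posdefmx X : Prop :=
  X^T = X /\ forall v : 'cV[R]_q, v != 0 -> 0 < (v^T *m X *m v) 0 0.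

Definition negdefmx X : Prop :=
  X^T = X /\ forall v : 'cV[R]_q, v != 0 -> (v^T *m X *m v) 0 0 < 0.

Definition He X : 'M[R]_q := X^T + X.

End Definiteness.

Section Stability.
Variables (R : realType) (n : nat).

(* A discrete-time linear system is given by the set of its trajectories, which
   start at time 0: Lyapunov stability and attractivity of the origin. The norm
   is the max norm on column vectors. *)
Definition asymptotically_stable (traj : set (nat -> 'cV[R]_n)) : Prop :=
  (forall e : R, 0 < e -> exists2 d : R, 0 < d &
     forall x, traj x -> `|x 0%N| < d -> forall k, `|x k| < e) /\
  (forall x, traj x -> x k @[k --> \oo] --> (0 : 'cV[R]_n)).

Definition lti_system (M : 'M[R]_n) : set (nat -> 'cV[R]_n) :=
  [set phi | forall t, phi t.+1 = M *m phi t].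

End Stability.

Section Gains.
Variables (R : realType) (N m p : nat).
Implicit Types F : 'M[R]_(N * m, N * p).

(* Block (k, j) of size m x p, both indices counted from 0; it is zero when an
   index is out of range. *)
Definition block F (k j : nat) : 'M[R]_(m, p) :=
  if (insub k, insub j) is (Some k', Some j')
  then \matrix_(a, b) F (mxtens_index (k', a)) (mxtens_index (j', b))
  else 0.

Definition structured F : Prop :=
  forall k j : nat, (k < j < N)%N -> block F k j = 0.

(* F^(k,i), for i <= k < N, is the block in row k and column k - i. *)
Definition gain F (k i : nat) : 'M[R]_(m, p) := block F k (k - i).

(* Block row k of a structured matrix is F^(k,k), ..., F^(k,1), F^(k,0),
   followed by zero blocks. *)
Lemma structuredE F : structured F ->
  F = \sum_(k < N) \sum_(j < N | (j <= k)%N) delta_mx k j *t gain F k (k - j).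
Proof.
move=> sF; apply/matrixP => r s.
case: (mxtens_indexP r) => k a; case: (mxtens_indexP s) => j b.
have blockE (k1 j1 : 'I_N) a1 b1 : block F k1 j1 a1 b1 =
    F (mxtens_index (k1, a1)) (mxtens_index (j1, b1)).
  by rewrite /block !valK mxE.
rewrite summxE (bigD1 k) //= [X in _ + X]big1 ?addr0; last first.
  move=> k1 /negPf nk; rewrite summxE big1 // => j1 _.
  by rewrite !mxE !mxtens_indexK /= eq_sym nk mul0r.
rewrite summxE; have [jk|kj] := leqP j k; last first.
  rewrite -blockE sF ?kj ?ltn_ord // mxE big1 // => j1 j1k.
  have nj : (j == j1) = false := gtn_eqF (leq_ltn_trans j1k kj).
  by rewrite !mxE !mxtens_indexK /= nj andbF mul0r.
rewrite (bigD1 j) //= [X in _ + X]big1 ?addr0; last first.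
  move=> j1 /andP[_ /negPf nj].
  by rewrite !mxE !mxtens_indexK /= [j == j1]eq_sym nj andbF mul0r.
by rewrite mxE mxE !mxtens_indexK /= !eqxx mul1r /gain subKn // blockE.
Qed.

End Gains.

Section ClosedLoop.
Variables (R : realType) (N n m p : nat).
Variables (A : 'M[R]_n) (B : 'M[R]_(n, m)) (C : 'M[R]_(p, n)).
Variable F : 'M[R]_(N * m, N * p).

Definition periodic_system : set (nat -> 'cV[R]_n) :=
  [set x | forall k, x k.+1 =
     A *m x k +
     B *m \sum_(i < (k %% N).+1) gain F (k %% N) i *m C *m x (k - i)%N].

(* [:: Phi d; Phi d.-1; ...; Phi 0], so that item i is Phi (d - i). *)
Fixpoint Phi_hist (d : nat) : seq 'M[R]_n :=
  if d is d'.+1 then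
    let h := Phi_hist d' in
    (A *m h`_0 + B *m \sum_(i < d'.+1) gain F d' i *m C *m h`_i) :: h
  else [:: 1%:M].

Definition Phi (d : nat) : 'M[R]_n := (Phi_hist d)`_0.

Lemma Phi0 : Phi 0 = 1%:M.
Proof. by []. Qed.

Lemma PhiS d : Phi d.+1 =
  A *m Phi d + B *m \sum_(i < d.+1) gain F d i *m C *m Phi (d - i).
Proof.
rewrite {1}/Phi /=; congr (_ + _ *m _); apply: eq_bigr => i _; congr (_ *m _).
have : (i <= d)%N by rewrite -ltnS.
move: (nat_of_ord i) => k {i}; rewrite /Phi.
by elim: d k => [|d IHd] [|k] //=; exact: IHd.
Qed.

Definition A_LTI : 'M[R]_n := Phi N.

End ClosedLoop.

Section LMI.
Variable R : realType.

(* Standard unit vector, with i counted from 1. *)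
Definition unitvec (q i : nat) : 'cV[R]_q := \col_j (j.+1 == i)%:R.

Definition Lmx (N : nat) : 'M[R]_(N.-1, N) :=
  \matrix_(i, j) (i == j :> nat)%:R.

Definition Rmx (N : nat) : 'M[R]_(N.-1, N) :=
  \matrix_(i, j) (i.+1 == j :> nat)%:R.

Definition Xmx (N n : nat) (P : 'M[R]_n) (g : R) : 'M[R]_(N.+1 * n) :=
  (- g *: (unitvec N.+1 1 *m (unitvec N.+1 1)^T)
   + unitvec N.+1 N.+1 *m (unitvec N.+1 N.+1)^T) *t P.

Lemma Pimx_rows (N n : nat) : (1 * n + N * n)%N = (N.+1 * n)%N.
Proof. by rewrite -mulnDl. Qed.

Definition Pimx (N n m : nat) (A : 'M[R]_n) (B : 'M[R]_(n, m)) :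
    'M[R]_(N.+1 * n, N * n + N * m) :=
  castmx (Pimx_rows N n, erefl)
    (block_mx ((unitvec N 1)^T *t (1%:M : 'M[R]_n)) 0
              ((1%:M : 'M[R]_N) *t A)               ((1%:M : 'M[R]_N) *t B)).

Definition Cmx (N n m p : nat) (A : 'M[R]_n) (B : 'M[R]_(n, m))
    (C : 'M[R]_(p, n)) (F : 'M[R]_(N * m, N * p)) :
    'M[R]_(N * m + N.-1 * n, N * n + N * m) :=
  block_mx (F *m ((1%:M : 'M[R]_N) *t C))         (- ((1%:M : 'M[R]_N) *t (1%:M : 'M[R]_m)))
           (Lmx N *t A - Rmx N *t (1%:M : 'M[R]_n)) (Lmx N *t B).

End LMI.

(* Main.v *)
Require Import Defs.
From HB Require Import structures.
From mathcomp Require Import all_boot all_order all_algebra.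
From mathcomp Require Import mxtens.
From mathcomp Require Import all_classical all_reals all_analysis.
From mathcomp Require Import ring lra zify.

Set Implicit Arguments.
Unset Strict Implicit.
Unset Printing Implicit Defensive.

Import Order.TTheory GRing.Theory Num.Theory.
Import numFieldNormedType.Exports.

Local Open Scope classical_set_scope.
Local Open Scope ring_scope.

(** The periodic loop is sampled once per period. Over one period its states are
    x(N t + d) = Phi_d x(N t), so the samples follow A_LTI = Phi_N, and every
    state is bounded by a fixed multiple of the last sample; conversely each
    trajectory of A_LTI extends to a periodic one by the same formula. This
    transfers stability between the two systems ([periodic_stableP]).

    Stability of a matrix A is equivalent to the existence of P > 0 with
    A^T P A - P < 0 ([attractive_lyapunov], [lyapunov_stable]). From a power
    with A^k contracting the Euclidean norm, the finite sum of the
    (A^i)^T A^i over i < k is already such a P, since its Lyapunov difference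
    telescopes to (A^k)^T A^k - 1. In the other direction, the norm and the
    quadratic forms of P and of P - A^T P A bound each other up to constants, so
    the form of P decays geometrically along trajectories.

    The kernel of C(F) consists of the stacked states and inputs
    (x_0, ..., x_{N-1}, u_0, ..., u_{N-1}) of the closed loop over one period:
    its top block row is the controller and its bottom block row the plant. A
    kernel vector is determined by x_0, which is arbitrary. The map Pi_N sends it
    to (x_0, ..., x_N), so the quadratic form of Pi_N^T X_N(P,1) Pi_N takes
    there the value x_N^T P x_N - x_0^T P x_0 with x_N = A_LTI x_0
    ([qform_Cmx_kernel]). Thus the Lyapunov inequality for A_LTI says that this
    form is negative on the nonzero vectors of the kernel of C(F), which by
    Finsler's lemma ([finsler]) is the existence of the multiplier M
    ([lyapunov_LMI]). *)

(** * Quadratic forms and Finsler's lemma *)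

Definition qform (R : realType) (q : nat) (X : 'M[R]_q) (v : 'cV[R]_q) : R :=
  (v^T *m X *m v) 0 0.

Section QuadraticForms.
Variables (R : realType) (q : nat).
Implicit Types (X Y : 'M[R]_q) (u v : 'cV[R]_q).

Lemma qformD X Y v : qform (X + Y) v = qform X v + qform Y v.
Proof. by rewrite /qform mulmxDr mulmxDl mxE. Qed.

Lemma qformN X v : qform (- X) v = - qform X v.
Proof. by rewrite /qform mulmxN mulNmx mxE. Qed.

Lemma qformB X Y v : qform (X - Y) v = qform X v - qform Y v.
Proof. by rewrite qformD qformN. Qed.

Lemma qform_sum (I : Type) (r : seq I) (F : I -> 'M[R]_q) v :
  qform (\sum_(i <- r) F i) v = \sum_(i <- r) qform (F i) v.
Proof. by rewrite /qform mulmx_sumr mulmx_suml summxE. Qed.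

Lemma qform0r X : qform X 0 = 0.
Proof. by rewrite /qform mulmx0 mxE. Qed.

Lemma qform_congr k X (L : 'M[R]_(q, k)) (v : 'cV[R]_k) :
  qform (L^T *m X *m L) v = qform X (L *m v).
Proof. by rewrite /qform trmx_mul !mulmxA. Qed.

Lemma qform1 v : qform 1%:M v = \sum_i v i 0 ^+ 2.
Proof.
by rewrite /qform mulmx1 mxE; apply: eq_bigr => i _; rewrite mxE -expr2.
Qed.

Lemma qform1_ge0 v : 0 <= qform 1%:M v.
Proof. by rewrite qform1 sumr_ge0 // => i _; rewrite sqr_ge0. Qed.

Lemma qform_He X v : qform (He X) v = 2 * qform X v.
Proof.
rewrite /He qformD; suff -> : qform X^T v = qform X v.
  by rewrite mulr2n mulrDl mul1r.
transitivity ((v^T *m X *m v)^T 0 0); last exact: mxE.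
by rewrite !trmx_mul trmxK mulmxA.
Qed.

Lemma posdefmx1 : posdefmx (1%:M : 'M[R]_q).
Proof.
split=> [|v v0]; first exact: trmx1.
rewrite -/(qform _ _) lt_neqAle qform1_ge0 andbT eq_sym.
apply: contra v0; rewrite qform1 psumr_eq0 => [/allP h|i _]; last exact: sqr_ge0.
apply/eqP/colP => i; rewrite mxE; apply/eqP.
by have := h i (mem_index_enum i); rewrite /= sqrf_eq0.
Qed.

Lemma posdefmx_ge0 X v : posdefmx X -> 0 <= qform X v.
Proof.
case=> _ pX; have [->|/pX/ltW //] := eqVneq v 0.
by rewrite qform0r.
Qed.

Lemma negdefmxN X : negdefmx X -> posdefmx (- X).
Proof.
case=> sX nX; split=> [|v /nX]; first by rewrite linearN /= sX.
by rewrite -!/(qform _ _) qformN oppr_gt0.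
Qed.

Lemma posdefmx_unit X : posdefmx X -> X \in unitmx.
Proof.
case=> sX pX; rewrite -row_free_unit -kermx_eq0; apply/rowV0P => v.
move/sub_kermxP => vX; apply/eqP; apply: contraT => v0.
have := pX v^T; rewrite trmxK vX mul0mx mxE ltxx; apply.
by apply: contra v0 => /eqP h; rewrite -[v]trmxK h trmx0.
Qed.

(** With a = u^T X u and b = u^T X v, the form at a v - b u equals
    a (a (v^T X v) - b^2), and a > 0 unless u = 0. *)
Lemma posdefmx_CauchySchwarz X u v : posdefmx X ->
  (u^T *m X *m v) 0 0 ^+ 2 <= qform X u * qform X v.
Proof.
move=> pX; have [sX pXq] := pX; have [->|u0] := eqVneq u 0.
  by rewrite trmx0 !mul0mx qform0r mxE expr0n mul0r.
set b := (u^T *m X *m v) 0 0; set a := qform X u.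
have a0 : 0 < a by exact: pXq.
have bE : (v^T *m X *m u) 0 0 = b.
  transitivity ((u^T *m X *m v)^T 0 0); last exact: mxE.
  by rewrite !trmx_mul trmxK sX mulmxA.
have : 0 <= qform X (a *: v - b *: u) by exact: posdefmx_ge0.
have -> : qform X (a *: v - b *: u) = a * (a * qform X v - b ^+ 2).
  have trE : (a *: v - b *: u)^T = a *: v^T - b *: u^T.
    by rewrite linearB /= !linearZ.
  rewrite {1}/qform trE mulmxBl mulmxBl !mulmxBr -!scalemxAl -!scalemxAr.
  have entry (x y z t : 'M[R]_1) : (x - y - (z - t)) 0 0
      = x 0 0 - y 0 0 - (z 0 0 - t 0 0) by rewrite !mxE.
  have entryZ (x : 'M[R]_1) c d : (c *: (d *: x)) 0 0 = c * (d * x 0 0).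
    by rewrite !mxE.
  by rewrite entry !entryZ bE -/b -!/(qform _ _) -/a; ring.
by rewrite pmulr_rge0 // subr_ge0.
Qed.

Lemma coord_le_norm v i : `|v i 0| <= `|v|.
Proof.
rewrite [leRHS]/Num.norm /= mx_normrE; apply/bigmax_geP; right => /=.
by exists (i, 0).
Qed.

Lemma norm_attained v : `|v| = 0 \/ exists i, `|v| = `|v i 0|.
Proof.
have [->|v0] := eqVneq `|v| 0; [by left | right].
have [[i j] vE] := mx_norm_neq0 v0; exists i; rewrite [LHS]vE /=.
by rewrite [j]ord1.
Qed.

Lemma qform_le_sqrnorm X :
  exists2 c : R, 0 < c & forall v, qform X v <= c * `|v| ^+ 2.
Proof.
exists (1 + \sum_i \sum_j `|X i j|) => [|v].
  by rewrite ltr_pwDl // !sumr_ge0 // => i _; rewrite sumr_ge0.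
apply: (@le_trans _ _ ((\sum_i \sum_j `|X i j|) * `|v| ^+ 2)); last first.
  by rewrite ler_wpM2r ?sqr_ge0 // lerDr.
rewrite /qform mxE exchange_big /= mulr_suml ler_sum // => j _.
rewrite mxE !mulr_suml ler_sum // => i _; rewrite mxE.
apply: le_trans (ler_norm _) _; rewrite !normrM mulrAC mulrC expr2.
by rewrite ler_wpM2l // ler_pM // coord_le_norm.
Qed.

(** Coordinate i of v is the X-inner product of v with the vector
    w i = X^-1 e_i, so the Cauchy-Schwarz inequality gives the bound with an
    explicit constant, in place of a compactness argument on the unit sphere. *)
Lemma sqrnorm_le_posdef X : posdefmx X ->
  exists2 c : R, 0 < c & forall v, `|v| ^+ 2 <= c * qform X v.
Proof.
move=> pX; pose w i : 'cV[R]_q := invmx X *m delta_mx i 0.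
(* The summand 1 keeps the constant positive when the dimension is zero. *)
exists (1 + \sum_i qform X (w i)) => [|v].
  by rewrite ltr_pwDl // sumr_ge0 // => i _; exact: posdefmx_ge0.
have [->|[i ->]] := norm_attained v.
  rewrite expr0n mulr_ge0 ?posdefmx_ge0 // addr_ge0 // sumr_ge0 // => i _.
  exact: posdefmx_ge0.
have -> : v i 0 = ((w i)^T *m X *m v) 0 0.
  rewrite /w trmx_mul trmx_inv (proj1 pX) -!mulmxA mulKmx ?posdefmx_unit //.
  by rewrite trmx_delta -rowE mxE.
rewrite real_normK ?num_real //.
apply: le_trans (posdefmx_CauchySchwarz _ _ pX) _.
rewrite ler_wpM2r ?posdefmx_ge0 // (bigD1 i) //= addrCA lerDl addr_ge0 //.
by rewrite sumr_ge0 // => j _; exact: posdefmx_ge0.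
Qed.

End QuadraticForms.

Lemma norm_mulmx_le (R : realType) (q r : nat) (L : 'M[R]_(q, r)) (v : 'cV[R]_r) :
  `|L *m v| <= (\sum_j `|col j L|) * `|v|.
Proof.
have -> : L *m v = \sum_j v j 0 *: col j L.
  apply/colP => i; rewrite mxE summxE; apply: eq_bigr => j _.
  by rewrite !mxE mulrC.
apply: le_trans (ler_norm_sum _ _ _) _; rewrite mulr_suml ler_sum // => j _.
by rewrite normrZ mulrC ler_wpM2l // coord_le_norm.
Qed.

(** Finsler's lemma. Take D with L D L = L and W = 1 - D L, which maps into the
    kernel of L. Splitting X along 1 = D L + W, every term of X other than
    W^T X W has a factor L on the right or L^T on the left, so a multiplier
    can cancel it and leave - L^T L instead. The resulting form is
    negative: if L v = 0 then W v = v, and otherwise the second term is negative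
    and the first is not positive. *)
Lemma finsler (R : realType) (q r : nat) (X : 'M[R]_q) (L : 'M[R]_(r, q)) :
    X^T = X -> (forall v, L *m v = 0 -> v != 0 -> qform X v < 0) ->
  exists M : 'M[R]_(q, r), negdefmx (X + He (M *m L)).
Proof.
move=> sX negX; have [D LDL] : exists D, L *m D *m L = L.
  by exists (pinvmx L); rewrite mulmxKpV.
pose W : 'M[R]_q := 1%:M - D *m L.
have LW : L *m W = 0 by rewrite mulmxBr mulmx1 mulmxA LDL subrr.
have WE : 1%:M = D *m L + W by rewrite addrC subrK.
move: W LW WE => W LW WE.
pose Y : 'M[R]_r := D^T *m X *m D + 1%:M.
pose M : 'M[R]_(q, r) := - (2^-1 *: (L^T *m Y) + W^T *m X *m D).
have key : X + He (M *m L) = W^T *m X *m W - L^T *m L.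
  have YE : L^T *m Y *m L = L^T *m D^T *m X *m D *m L + L^T *m L.
    by rewrite /Y mulmxDr mulmxDl mulmx1 !mulmxA.
  have sY : Y^T = Y.
    by rewrite /Y (linearD trmx) /= !trmx_mul trmxK trmx1 sX !mulmxA.
  have -> : He (M *m L) = - (L^T *m Y *m L)
      - L^T *m D^T *m X *m W - W^T *m X *m D *m L.
    rewrite /He /M mulNmx mulmxDl -scalemxAl (linearN trmx) /= (linearD trmx) /=.
    rewrite (linearZ _ (_ *m _)) /= !trmx_mul !trmxK sX sY !mulmxA.
    by apply/matrixP => i j; rewrite !mxE; lra.
  have {1}-> : X = (D *m L + W)^T *m X *m (D *m L + W).
    by rewrite -WE trmx1 mul1mx mulmx1.
  rewrite YE (linearD trmx) /= trmx_mul !mulmxDl !mulmxDr !mulmxA.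
  set a1 := L^T *m D^T *m X *m D *m L; set a2 := _ *m W; set a3 := _ *m L.
  set a4 := _ *m W; set a5 := L^T *m L.
  rewrite opprD; move: a1 a2 a3 a4 a5 => a1 a2 a3 a4 a5.
  by apply/matrixP => i j; rewrite !mxE; ring.
exists M; rewrite key; split=> [|v v0].
  by rewrite linearB /= !trmx_mul !trmxK sX !mulmxA.
rewrite -/(qform _ _) qformB qform_congr.
have -> : qform (L^T *m L) v = qform 1%:M (L *m v).
  by rewrite -qform_congr mulmx1.
have LWv : L *m (W *m v) = 0 by rewrite mulmxA LW mul0mx.
have vE : v = D *m (L *m v) + W *m v by rewrite mulmxA -mulmxDl -WE mul1mx.
have [Lv0|Lv0] := eqVneq (L *m v) 0.
  rewrite Lv0 qform0r subr0 negX //.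
  by apply: contra v0 => /eqP Wv0; rewrite vE Lv0 Wv0 mulmx0 addr0.
have lt0 : 0 < qform 1%:M (L *m v) by exact: (proj2 (posdefmx1 R r)).
have [->|Wv0] := eqVneq (W *m v) 0; first by rewrite qform0r sub0r oppr_lt0.
by rewrite subr_lt0 (lt_trans _ lt0) // negX.
Qed.

(** * Lyapunov inequalities and asymptotic stability *)

Section Lyapunov.
Variables (R : realType) (n : nat) (A : 'M[R]_n).

Lemma lti_system_pow v : lti_system A (fun t => A ^+ t *m v).
Proof. by move=> t /=; rewrite exprS mulmxA. Qed.

Lemma cvg0_geometric (c rho : R) (u : nat -> 'cV[R]_n) :
    0 <= rho < 1 -> (forall t, `|u t| ^+ 2 <= c * rho ^+ t) ->
  u t @[t --> \oo] --> (0 : 'cV[R]_n).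
Proof.
move=> /andP[rho0 rho1] uP; apply/cvgr0Pnorm_lt => e e0.
have cvg : (fun t => c * rho ^+ t) @ \oo --> (0 : R).
  rewrite -(mulr0 c); apply: cvgMr; apply: cvg_expr.
  by rewrite ger0_norm.
have e20 : 0 < e ^+ 2 by rewrite exprn_gt0.
near=> t; rewrite -ltr_sqr ?nnegrE ?normr_ge0 ?ltW //.
apply: le_lt_trans (uP t) _; apply: le_lt_trans (ler_norm _) _.
by near: t; move/cvgr0Pnorm_lt: cvg => /(_ _ e20).
Unshelve. all: by end_near. Qed.

(** The form of P decreases at each step by the form of P - A^T P A, which is at
    least a fixed fraction 1 / k of it; hence it decays geometrically, and
    it controls the norm from both sides. *)
Lemma lyapunov_stable P : posdefmx P -> negdefmx (A^T *m P *m A - P) ->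
  asymptotically_stable (lti_system A).
Proof.
move=> pP nD; have pQ := negdefmxN nD.
have [a a0 normP] := sqrnorm_le_posdef pP.
have [b b0 Pnorm] := qform_le_sqrnorm P.
have [c c0 normQ] := sqrnorm_le_posdef pQ.
(* b * c bounds the form of P by that of P - A^T P A; adding 1 makes the rate
   rho nonnegative. *)
pose k := 1 + b * c; pose rho := 1 - k^-1.
have k1 : 1 < k by rewrite ltrDl mulr_gt0.
have k0 : 0 < k by exact: lt_trans k1.
have rho0 : 0 <= rho by rewrite subr_ge0 invf_le1 // ltW.
have rho1 : rho < 1 by rewrite gtrBl invr_gt0.
have step v : qform P (A *m v) <= rho * qform P v.
  have := Pnorm v; have := normQ v.
  rewrite qformN qformB qform_congr opprB => h1 h2.
  have h3 : qform P v <= k * (qform P v - qform P (A *m v)).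
    rewrite /k mulrDl mul1r ler_wpDl //.
      by rewrite -[_ - _]opprB -qform_congr -qformB -qformN posdefmx_ge0.
    by rewrite -mulrA (le_trans h2) // ler_pM2l.
  rewrite /rho mulrBl mul1r lerBrDr -lerBrDl.
  by rewrite mulrC ler_pdivrMr // mulrC.
have decay x : lti_system A x ->
    forall t, qform P (x t) <= rho ^+ t * qform P (x 0%N).
  move=> Ax; elim=> [|t IHt]; first by rewrite expr0 mul1r.
  by rewrite Ax (le_trans (step _)) // exprS -mulrA ler_wpM2l.
have bound x : lti_system A x ->
    forall t, `|x t| ^+ 2 <= a * qform P (x 0%N) * rho ^+ t.
  move=> Ax t; apply: le_trans (normP _) _.
  by rewrite -mulrA [_ * rho ^+ t]mulrC ler_pM2l // decay.
split=> [e e0|x Ax]; last first.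
  by apply: cvg0_geometric (bound _ Ax); rewrite rho0 rho1.
(* The norm of x t is at most sqrt (a * b) times that of x 0, and
   a * b < (1 + a * b)^2, which avoids the square root. *)
pose d := e / (1 + a * b); have ab0 : 0 < 1 + a * b by rewrite addr_gt0 ?mulr_gt0.
exists d => [|x Ax x0d t]; first by rewrite divr_gt0.
rewrite -ltr_sqr ?nnegrE ?normr_ge0 ?ltW //.
apply: (@le_lt_trans _ _ (a * (b * `|x 0%N| ^+ 2))).
  apply: le_trans (bound _ Ax t) _; rewrite -mulrA ler_pM2l //.
  apply: le_trans (Pnorm _); rewrite ler_piMr ?posdefmx_ge0 //.
  by rewrite exprn_ile1 // ltW.
have : `|x 0%N| ^+ 2 < d ^+ 2.
  by rewrite ltr_sqr ?nnegrE ?normr_ge0 // divr_ge0 // ltW.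
rewrite -(ltr_pM2l (mulr_gt0 a0 b0)) mulrA => /lt_le_trans; apply.
have -> : e = d * (1 + a * b) by rewrite /d divfK // gt_eqF.
move: d {x0d} => d; rewrite exprMn [d ^+ 2 * _]mulrC ler_wpM2r ?sqr_ge0 //.
have ab1 := mulr_gt0 a0 b0; nra.
Qed.

(** Column j of A^t is the state at time t of the trajectory from the unit vector
    e_j; finitely many columns are small simultaneously. *)
Lemma attractive_pow_small (e : R) : 0 < e ->
    (forall x, lti_system A x -> x t @[t --> \oo] --> (0 : 'cV[R]_n)) ->
  exists2 k : nat, (0 < k)%N & forall v : 'cV[R]_n, `|A ^+ k *m v| <= e * `|v|.
Proof.
move=> e0 attr; pose e' := e / n.+1%:R.
have e'0 : 0 < e' by rewrite divr_gt0.
have small j : \forall t \near \oo, `|col j (A ^+ t)| < e'.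
  have := attr _ (lti_system_pow (delta_mx j 0)).
  move/(cvgr0_norm_lt (FF := _)) => /(_ _ e'0).
  by apply: filterS => t; rewrite -colE.
have : \forall t \near \oo, forall j, `|col j (A ^+ t)| < e'.
  by apply: filter_forall.
move=> [K _ KP]; (* K itself could be 0. *)
exists K.+1 => // v.
apply: le_trans (norm_mulmx_le _ _) _; rewrite ler_wpM2r //.
apply: (@le_trans _ _ (\sum_(j < n) e')).
  by apply: ler_sum => j _; rewrite ltW // KP /=.
rewrite sumr_const card_ord -mulr_natr /e' mulrAC ler_pdivrMr //.
by rewrite ler_pM2l // ler_nat.
Qed.

(** P is the sum of (A^i)^T A^i over i < k, where A^k contracts the Euclidean
    norm. This truncation of the usual Lyapunov series raises no convergence
    question; the term i = 0 makes P positive definite, and k > 0 ensures that it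
    is present. *)
Lemma attractive_lyapunov :
    (forall x, lti_system A x -> x t @[t --> \oo] --> (0 : 'cV[R]_n)) ->
  exists P, posdefmx P /\ negdefmx (A^T *m P *m A - P).
Proof.
move=> attr; have p1 := @posdefmx1 R n.
have [a a0 norm1] := sqrnorm_le_posdef p1.
have [b b0 le1] := qform_le_sqrnorm (1%:M : 'M[R]_n).
pose e := (1 + a * b)^-1; have ab0 := mulr_gt0 a0 b0.
have e0 : 0 < e by rewrite invr_gt0 addr_gt0.
have [k k0 kP] := attractive_pow_small e0 attr.
have contr (v : 'cV[R]_n) : v != 0 -> qform 1%:M (A ^+ k *m v) < qform 1%:M v.
  move=> v0; have qv0 : 0 < qform 1%:M v by exact: (proj2 p1).
  apply: le_lt_trans (le1 _) _.
  have h1 : `|A ^+ k *m v| ^+ 2 <= e ^+ 2 * (a * qform 1%:M v).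
    apply: (@le_trans _ _ ((e * `|v|) ^+ 2)).
      by rewrite ler_sqr ?nnegrE ?mulr_ge0 // ltW.
    by rewrite exprMn ler_pM2l ?exprn_gt0.
  have : b * `|A ^+ k *m v| ^+ 2 <= b * (e ^+ 2 * (a * qform 1%:M v)).
    by rewrite ler_pM2l.
  move=> /le_lt_trans; apply.
  rewrite (_ : _ * _ = (a * b * e ^+ 2) * qform 1%:M v); last by ring.
  rewrite gtr_pMl // /e exprVn ltr_pdivrMr ?exprn_gt0 ?addr_gt0 //.
  by rewrite mul1r; nra.
pose P := \sum_(i < k) ((A ^+ i)^T *m 1%:M *m A ^+ i).
have PE v : qform P v = \sum_(i < k) qform 1%:M (A ^+ i *m v).
  by rewrite /P qform_sum; apply: eq_bigr => i _; rewrite qform_congr.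
have sP : P^T = P.
  rewrite /P linear_sum; apply: eq_bigr => i _ /=.
  by rewrite !trmx_mul trmxK trmx1 mulmxA.
exists P; split.
- split=> // v v0; rewrite -/(qform _ _) PE; case: k k0 {kP contr P PE sP} => // k _.
  rewrite big_ord_recl expr0 mul1mx ltr_wpDr ?(proj2 p1) //.
  by rewrite sumr_ge0 // => i _; exact: qform1_ge0.
- split=> [|v v0]; first by rewrite linearB /= !trmx_mul trmxK sP mulmxA.
  rewrite -/(qform _ _) qformB qform_congr !PE.
  have -> : \sum_(i < k) qform 1%:M (A ^+ i *m (A *m v))
          = \sum_(i < k) qform 1%:M (A ^+ i.+1 *m v).
    by apply: eq_bigr => i _; rewrite exprSr mulmxA.
  pose f i := qform 1%:M (A ^+ i *m v); rewrite -sumrB.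
  rewrite -(big_mkord xpredT (fun i => f i.+1 - f i)) telescope_sumr //.
  by rewrite /f expr0 mul1mx subr_lt0 contr.
Qed.

End Lyapunov.

(** * Sampling the periodic closed loop *)

Section PeriodicLifting.
Variables (R : realType) (N n m p : nat) (N_gt0 : (0 < N)%N).
Variables (A : 'M[R]_n) (B : 'M[R]_(n, m)) (C : 'M[R]_(p, n)).
Variable F : 'M[R]_(N * m, N * p).

(** One closed-loop step inside a period. Both the periodic system, with z i the
    state at time N t + i, and the kernel of C(F), with z i a block of its
    vector, satisfy the recursion of Phi through it. *)
Lemma closed_loop_PhiS (z : nat -> 'cV[R]_n) (w : 'cV[R]_n) d :
    (forall i, (i <= d)%N -> z i = Phi A B C F i *m w) ->
  A *m z d + B *m \sum_(i < d.+1) gain F d i *m C *m z (d - i)%N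
    = Phi A B C F d.+1 *m w.
Proof.
move=> zE; rewrite PhiS mulmxDl -!mulmxA mulmx_suml zE //; congr (_ + _ *m _).
by apply: eq_bigr => i _; rewrite zE ?leq_subr // !mulmxA.
Qed.

Lemma periodic_systemE x : periodic_system A B C F x ->
  forall t d, (d <= N)%N -> x (N * t + d)%N = Phi A B C F d *m x (N * t)%N.
Proof.
move=> px t d; have [k] := ubnP d; elim: k d => // k IHk [|d] dk dN.
  by rewrite addn0 Phi0 mul1mx.
rewrite addnS px -(closed_loop_PhiS (z := fun i => x (N * t + i)%N)); last first.
  by move=> i id; apply: IHk; lia.
rewrite mulnC modnMDl modn_small //; congr (_ + _ *m _).
by apply: eq_bigr => i _; congr (_ *m x _); have := ltn_ord i; lia.
Qed.

Lemma periodic_sample x : periodic_system A B C F x ->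
  lti_system (A_LTI A B C F) (fun t => x (N * t)%N).
Proof. by move=> px t; rewrite mulnS addnC (periodic_systemE px). Qed.

Lemma periodic_extension phi : lti_system (A_LTI A B C F) phi ->
  periodic_system A B C F (fun k => Phi A B C F (k %% N) *m phi (k %/ N)%N).
Proof.
move=> Aphi k; set d := (k %% N)%N; set t := (k %/ N)%N.
have dN : (d < N)%N by rewrite ltn_mod.
have kE : k = (t * N + d)%N by exact: divn_eq.
pose z i := Phi A B C F i *m phi t.
have sumE : \sum_(i < d.+1) gain F d i *m C *m
      (Phi A B C F ((k - i) %% N) *m phi ((k - i) %/ N)%N)
    = \sum_(i < d.+1) gain F d i *m C *m z (d - i)%N.
  apply: eq_bigr => i _; have id := ltn_ord i.
  have -> : (k - i = t * N + (d - i))%N by lia.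
  by rewrite modnMDl divnMDl // modn_small ?divn_small ?addn0 //; lia.
rewrite sumE (@closed_loop_PhiS z (phi t)) //.
have -> : k.+1 = (t * N + d.+1)%N by lia.
have [dN1|] := ltnP d.+1 N.
  by rewrite modnMDl divnMDl // modn_small // divn_small // addn0.
(* At the end of a period the next state is phi t.+1 = Phi N *m phi t. *)
move=> Nd; have -> : d.+1 = N by lia.
by rewrite modnMDl divnMDl // modnn divnn N_gt0 Phi0 mul1mx addn1 Aphi.
Qed.

(** There are only N matrices Phi_d inside a period, so one constant serves. *)
Lemma periodic_norm_le : exists2 c : R, 0 < c &
  forall x, periodic_system A B C F x ->
    forall k, `|x k| <= c * `|x (N * (k %/ N))%N|.
Proof.
pose S d := \sum_j `|col j (Phi A B C F d)|.
have S0 d : 0 <= S d by rewrite sumr_ge0.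
exists (1 + \sum_(d < N) S d) => [|x px k]; first by rewrite ltr_pwDl // sumr_ge0.
have kN : (k %% N < N)%N by rewrite ltn_mod.
have -> : x k = Phi A B C F (k %% N) *m x (N * (k %/ N))%N.
  by rewrite -(periodic_systemE px _ (ltnW kN)) mulnC -divn_eq.
apply: le_trans (norm_mulmx_le _ _) _; rewrite ler_wpM2r //.
by rewrite (bigD1 (Ordinal kN)) //= addrCA lerDl addr_ge0 // sumr_ge0.
Qed.

Lemma periodic_stableP :
  asymptotically_stable (periodic_system A B C F) <->
  asymptotically_stable (lti_system (A_LTI A B C F)).
Proof.
split=> -[stab attr]; split.
- move=> e /stab[d d0 dP]; exists d => // phi Aphi phi0 t.
  have := dP _ (periodic_extension Aphi).
  rewrite mod0n div0n Phi0 mul1mx => /(_ phi0 (N * t)%N).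
  by rewrite mulnC modnMl mulnK // Phi0 mul1mx.
- move=> phi Aphi; apply/cvgr0Pnorm_lt => e e0.
  have := attr _ (periodic_extension Aphi).
  move=> /cvgr0Pnorm_lt/(_ _ e0)[K _ KP]; exists K => // t /= Kt.
  have /= := KP (t * N)%N; rewrite modnMl mulnK // Phi0 mul1mx; apply.
  by rewrite (leq_trans Kt) // leq_pmulr.
- move=> e e0; have [c c0 xc] := periodic_norm_le.
  have [|d d0 dP] := stab (e / c); first by rewrite divr_gt0.
  exists d => // x px x0 k; apply: le_lt_trans (xc _ px _) _.
  rewrite mulrC -ltr_pdivlMr //; apply: (dP _ (periodic_sample px)).
  by rewrite muln0.
- have [c c0 xc] := periodic_norm_le.
  move=> x px; apply/cvgr0Pnorm_lt => e e0.
  have ec0 : 0 < e / c by rewrite divr_gt0.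
  have := attr _ (periodic_sample px).
  move=> /cvgr0Pnorm_lt/(_ _ ec0)[K _ KP]; exists (K * N)%N => // k /= Kk.
  apply: le_lt_trans (xc _ px _) _; rewrite mulrC -ltr_pdivlMr //.
  by apply: (KP (k %/ N)%N); rewrite /= leq_divRL.
Qed.

End PeriodicLifting.

(** * Block vectors and Kronecker products *)

Section BlockVectors.
Variable R : realType.

Definition blk q r (v : 'cV[R]_(q * r)) (i : 'I_q) : 'cV[R]_r :=
  \col_a v (mxtens_index (i, a)) 0.

Definition stack q r (f : 'I_q -> 'cV[R]_r) : 'cV[R]_(q * r) :=
  \col_s f (mxtens_unindex s).1 (mxtens_unindex s).2 0.

Lemma blk_stack q r (f : 'I_q -> 'cV[R]_r) i : blk (stack f) i = f i.
Proof. by apply/colP => a; rewrite !mxE mxtens_indexK. Qed.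

Lemma blk0 q r i : blk (0 : 'cV[R]_(q * r)) i = 0.
Proof. by apply/colP => a; rewrite !mxE. Qed.

Lemma blkD q r (u v : 'cV[R]_(q * r)) i : blk (u + v) i = blk u i + blk v i.
Proof. by apply/colP => a; rewrite !mxE. Qed.

Lemma blkN q r (v : 'cV[R]_(q * r)) i : blk (- v) i = - blk v i.
Proof. by apply/colP => a; rewrite !mxE. Qed.

Lemma blkP q r (u v : 'cV[R]_(q * r)) :
  (forall i, blk u i = blk v i) -> u = v.
Proof.
move=> uv; apply/colP => s; case: (mxtens_indexP s) => i a.
by have /colP/(_ a) := uv i; rewrite !mxE.
Qed.

Lemma sum_mxtens_index q r (G : 'I_(q * r) -> R) :
  \sum_s G s = \sum_i \sum_a G (mxtens_index (i, a)).
Proof.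
rewrite pair_bigA /= (reindex (@mxtens_index q r)) /=.
  by apply: eq_bigr => -[].
by exists (@mxtens_unindex q r) => s _; rewrite ?mxtens_indexK ?mxtens_unindexK.
Qed.

Lemma blk_tens q q' r r' (S : 'M[R]_(q, q')) (M : 'M[R]_(r, r')) v i :
  blk ((S *t M) *m v) i = \sum_j S i j *: (M *m blk v j).
Proof.
apply/colP => a; rewrite mxE summxE mxE sum_mxtens_index.
apply: eq_bigr => j _; rewrite !mxE mulr_sumr.
by apply: eq_bigr => b _; rewrite tensmxE mxE mulrA.
Qed.

(** All the 0-1 matrices in Pi_N and C(F) have a single 1 in each row, so they
    select a block. *)
Lemma blk_tens_select q q' r r' (S : 'M[R]_(q, q')) (M : 'M[R]_(r, r')) v i k :
  (forall j, S i j = (k == j)%:R) -> blk ((S *t M) *m v) i = M *m blk v k.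
Proof.
move=> SE; rewrite blk_tens (bigD1 k) //= SE eqxx scale1r big1 ?addr0 // => j.
by rewrite SE eq_sym => /negPf->; rewrite scale0r.
Qed.

Lemma blk_tens1 q r r' (M : 'M[R]_(r, r')) (v : 'cV[R]_(q * r')) i :
  blk ((1%:M *t M) *m v) i = M *m blk v i.
Proof. by apply: blk_tens_select => j; rewrite mxE. Qed.

Lemma blk_mul q m p (F : 'M[R]_(q * m, q * p)) w i :
  blk (F *m w) i = \sum_(j < q) block F i j *m blk w j.
Proof.
apply/colP => a; rewrite mxE summxE mxE sum_mxtens_index.
apply: eq_bigr => j _; rewrite mxE.
by apply: eq_bigr => b _; rewrite /block !valK !mxE.
Qed.

Lemma blk_dot q r (u v : 'cV[R]_(q * r)) :
  (u^T *m v) 0 0 = \sum_i ((blk u i)^T *m blk v i) 0 0.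
Proof.
rewrite mxE sum_mxtens_index; apply: eq_bigr => i _; rewrite mxE.
by apply: eq_bigr => a _; rewrite !mxE.
Qed.

Lemma blk_tens_unitvec q r (M : 'M[R]_r) (v : 'cV[R]_(q * r)) (a i : 'I_q) :
  blk ((unitvec R q a.+1 *m (unitvec R q a.+1)^T *t M) *m v) i
    = (i == a)%:R *: (M *m blk v a).
Proof.
have SE j : (unitvec R q a.+1 *m (unitvec R q a.+1)^T) i j
    = (i == a)%:R * (j == a)%:R.
  by rewrite mxE big_ord1 !mxE !eqSS.
rewrite blk_tens (bigD1 a) //= big1 ?addr0 => [|j /negPf ja].
  by rewrite SE eqxx mulr1.
by rewrite SE ja mulr0 scale0r.
Qed.

Lemma qform_tens_unitvec q r (M : 'M[R]_r) (v : 'cV[R]_(q * r)) (a : 'I_q) :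
  qform (unitvec R q a.+1 *m (unitvec R q a.+1)^T *t M) v = qform M (blk v a).
Proof.
rewrite /qform -!mulmxA blk_dot (bigD1 a) //= big1 ?addr0 => [|i /negPf ia].
  by rewrite blk_tens_unitvec eqxx scale1r mulmxA.
by rewrite blk_tens_unitvec ia scale0r mulmx0 mxE.
Qed.

End BlockVectors.

(** * The closed loop over one period as a linear matrix inequality *)

Section Lifting.
Variables (R : realType) (h n m p : nat).
Local Notation N := h.+1.
Variables (A : 'M[R]_n) (B : 'M[R]_(n, m)) (C : 'M[R]_(p, n)).
Implicit Types (xi : 'cV[R]_(N * n)) (eta : 'cV[R]_(N * m)).

Lemma qform_Xmx (P : 'M[R]_n) (y : 'cV[R]_(N.+1 * n)) :
  qform (Xmx N P 1) y = qform P (blk y ord_max) - qform P (blk y ord0).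
Proof.
rewrite -(qform_tens_unitvec _ _ ord_max) -(qform_tens_unitvec _ _ ord0).
rewrite -qformB; congr qform; rewrite /Xmx /=.
move: (unitvec _ _ _ *m _) (unitvec _ _ 1 *m _) => E2 E1.
by apply/matrixP => i j; rewrite !mxE; ring.
Qed.

Lemma Xmx_sym (P : 'M[R]_n) g : P^T = P -> (Xmx N P g)^T = Xmx N P g.
Proof.
move=> sP; rewrite /Xmx trmx_tens sP; congr (_ *t _).
by rewrite (linearD trmx) /= (linearZ _ (_ *m _)) /= !trmx_mul !trmxK.
Qed.

Lemma blk_castmx_col (a : 'cV[R]_(1 * n)) (b : 'cV[R]_(N * n)) :
  let y := castmx (Pimx_rows N n, erefl) (col_mx a b) in
  blk y ord0 = blk a ord0 /\ forall i, blk y (lift ord0 i) = blk b i.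
Proof.
move=> y; split=> [|i]; apply/colP => c; rewrite !mxE castmxE /= cast_ord_id.
  rewrite -(col_mxEu a b); congr (col_mx _ _ _ _); exact: val_inj.
rewrite -(col_mxEd a b); congr (col_mx _ _ _ _); apply: val_inj => /=.
by rewrite /bump /= mulnDl addnA.
Qed.

Lemma mul_castmx_rows q q' r s (e : q = q')
    (M : 'M[R]_(q, r)) (v : 'M[R]_(r, s)) :
  castmx (e, erefl) M *m v = castmx (e, erefl) (M *m v).
Proof. by case: _ / e; rewrite !castmx_id. Qed.

Lemma blk_Pimx xi eta :
  let y := Pimx N A B *m col_mx xi eta in
  blk y ord0 = blk xi ord0 /\
  forall i, blk y (lift ord0 i) = A *m blk xi i + B *m blk eta i.
Proof.
rewrite /Pimx mul_castmx_rows mul_block_col mul0mx addr0 /=.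
have [-> yS] := blk_castmx_col ((unitvec R N 1)^T *t 1%:M *m xi)
  (1%:M *t A *m xi + 1%:M *t B *m eta).
split=> [|i]; last by rewrite yS blkD !blk_tens1.
rewrite (@blk_tens_select _ _ _ _ _ _ _ _ _ ord0) ?mul1mx // => j.
by rewrite !mxE eq_sym.
Qed.

Variable F : 'M[R]_(N * m, N * p).

(** The two block rows of C(F) are the controller u = F (I (x) C) x and the plant
    equations x_{i+1} = A x_i + B u_i for the steps inside a period; the last
    step, which leaves the period, belongs to Pi_N instead. *)
Lemma Cmx_kernelE xi eta : Cmx A B C F *m col_mx xi eta = 0 <->
  (forall i, blk eta i = \sum_(j < N) block F i j *m (C *m blk xi j)) /\
  (forall i : 'I_h, blk xi (lift ord0 i) =
     A *m blk xi (widen_ord (leqnSn h) i) + B *m blk eta (widen_ord (leqnSn h) i)).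
Proof.
have blkL k l (M : 'M[R]_(k, l)) (v : 'cV[R]_(N * l)) (i : 'I_h) :
    blk ((Lmx R N *t M) *m v) i = M *m blk v (widen_ord (leqnSn h) i).
  by apply: blk_tens_select => j; rewrite mxE.
have blkR k l (M : 'M[R]_(k, l)) (v : 'cV[R]_(N * l)) (i : 'I_h) :
    blk ((Rmx R N *t M) *m v) i = M *m blk v (lift ord0 i).
  by apply: blk_tens_select => j; rewrite mxE.
rewrite /Cmx mul_block_col; set top := _ + _; set bot := (_ - _) *m _ + _.
have topE i : blk top i =
    (\sum_(j < N) block F i j *m (C *m blk xi j)) - blk eta i.
  rewrite /top blkD mulNmx blkN blk_tens1 mul1mx -mulmxA blk_mul; congr (_ - _).
  by apply: eq_bigr => j _; rewrite blk_tens1.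
have botE i : blk bot i = A *m blk xi (widen_ord (leqnSn h) i)
    + B *m blk eta (widen_ord (leqnSn h) i) - blk xi (lift ord0 i).
  by rewrite /bot mulmxBl blkD blkD blkN !blkL blkR mul1mx addrAC.
split=> [/eqP|[topP botP]].
  rewrite col_mx_eq0 => /andP[/eqP top0 /eqP bot0]; split=> i; apply/esym/eqP.
    by rewrite -subr_eq0 -topE top0 blk0.
  by rewrite -subr_eq0 -botE bot0 blk0.
apply/eqP; rewrite col_mx_eq0; apply/andP; split; apply/eqP/blkP => i.
  by rewrite topE blk0 -topP subrr.
by rewrite botE blk0 -botP subrr.
Qed.

Hypothesis sF : structured F.

(** Block lower triangularity is causality: block row d uses only the outputs up
    to time d. *)
Lemma structured_sum (g : nat -> 'cV[R]_p) (d : nat) : (d < N)%N ->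
  \sum_(j < N) block F d j *m g j = \sum_(i < d.+1) gain F d i *m g (d - i)%N.
Proof.
move=> dN; rewrite (bigID (fun j : 'I_N => (j < d.+1)%N)) /= [X in _ + X]big1.
  rewrite addr0 -(big_ord_widen N (fun j => block F d j *m g j) dN).
  by rewrite (reindex_inj rev_ord_inj).
by move=> j jd; rewrite sF ?mul0mx // ltn_ord andbT ltnNge.
Qed.

(** Kernel vectors are the closed-loop trajectories over one period; by causality
    the first state determines all others through the matrices Phi. *)
Lemma Cmx_kernel_Phi xi eta : Cmx A B C F *m col_mx xi eta = 0 <->
  (forall i : 'I_N, blk xi i = Phi A B C F i *m blk xi ord0) /\
  (forall i : 'I_N, blk eta i =
     \sum_(l < i.+1) gain F i l *m C *m blk xi (inord (i - l))).
Proof.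
have etaE (i : 'I_N) : \sum_(j < N) block F i j *m (C *m blk xi j) =
    \sum_(l < i.+1) gain F i l *m C *m blk xi (inord (i - l)).
  rewrite -[RHS](eq_bigr _ (fun l _ => mulmxA _ _ _)).
  rewrite -(structured_sum (fun j => C *m blk xi (inord j))) //.
  by apply: eq_bigr => j _; rewrite inord_val.
have inordE (i : 'I_N) : inord i = i by rewrite inord_val.
have step (i : 'I_N) :
    (forall l, (l <= i)%N -> blk xi (inord l) = Phi A B C F l *m blk xi ord0) ->
    blk eta i = \sum_(l < i.+1) gain F i l *m C *m blk xi (inord (i - l)) ->
    A *m blk xi i + B *m blk eta i = Phi A B C F i.+1 *m blk xi ord0.
  move=> xiE ->; rewrite -{1}(inordE i).
  exact: (closed_loop_PhiS (z := fun l => blk xi (inord l))).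
have liftE (i : 'I_h) : lift ord0 i = inord i.+1 :> 'I_N.
  by apply: val_inj; rewrite /= inordK // ltnS.
rewrite Cmx_kernelE; split=> [[etaP xiP]|[xiP etaP]].
  have xiE d : (d < N)%N -> blk xi (inord d) = Phi A B C F d *m blk xi ord0.
    have [k] := ubnP d; elim: k d => // k IHk [|d] dk dN.
      by rewrite Phi0 mul1mx; congr blk; exact: (inordE ord0).
    have dh : (d < h)%N by [].
    rewrite -(liftE (Ordinal dh)) xiP step ?etaP ?etaE // => l ld.
    by apply: IHk => /=; apply: leq_ltn_trans ld _ => //=; rewrite ltnW.
  by split=> i; [rewrite -xiE ?inordE | rewrite etaP etaE].
split=> [i|i]; first by rewrite etaP etaE.
rewrite xiP step ?etaP // => l li.
have lN : (l < N)%N := leq_ltn_trans li (ltn_ord _).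
by rewrite xiP inordK.
Qed.

Lemma Cmx_kernel_last xi eta : Cmx A B C F *m col_mx xi eta = 0 ->
  A *m blk xi ord_max + B *m blk eta ord_max = A_LTI A B C F *m blk xi ord0.
Proof.
move=> /Cmx_kernel_Phi[xiP etaP]; rewrite etaP -{1}[ord_max]inord_val.
apply: (closed_loop_PhiS (z := fun l => blk xi (inord l))) => l lh.
by rewrite xiP inordK.
Qed.

Lemma Cmx_kernel_exists w : exists v,
  Cmx A B C F *m v = 0 /\ blk (usubmx v) ord0 = w.
Proof.
pose xi := stack (fun i : 'I_N => Phi A B C F i *m w).
pose eta := stack (fun i : 'I_N =>
  \sum_(l < i.+1) gain F i l *m C *m blk xi (inord (i - l))).
exists (col_mx xi eta); rewrite col_mxKu.
have xi0 : blk xi ord0 = w by rewrite blk_stack Phi0 mul1mx.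
by split=> //; apply/Cmx_kernel_Phi; rewrite xi0; split=> i; rewrite blk_stack.
Qed.

Lemma Cmx_kernel_eq0 v : Cmx A B C F *m v = 0 -> blk (usubmx v) ord0 = 0 -> v = 0.
Proof.
rewrite -{1 3}[v]vsubmxK; move: (usubmx v) (dsubmx v) => xi eta.
move=> /Cmx_kernel_Phi[xiP etaP] xi0.
have xiE i : blk xi i = 0 by rewrite xiP xi0 mulmx0.
apply/eqP; rewrite col_mx_eq0; apply/andP; split; apply/eqP/blkP => i.
  by rewrite xiE blk0.
by rewrite etaP blk0 big1 // => l _; rewrite xiE mulmx0.
Qed.

Lemma qform_Cmx_kernel (P : 'M[R]_n) v : Cmx A B C F *m v = 0 ->
  qform ((Pimx N A B)^T *m Xmx N P 1 *m Pimx N A B) v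
  = qform ((A_LTI A B C F)^T *m P *m A_LTI A B C F - P) (blk (usubmx v) ord0).
Proof.
rewrite qform_congr qform_Xmx qformB qform_congr.
rewrite -{1 2 3}[v]vsubmxK; move: (usubmx v) (dsubmx v) => xi eta vP.
have [-> yS] := blk_Pimx xi eta.
have -> : ord_max = lift ord0 ord_max :> 'I_N.+1 by exact: val_inj.
by rewrite yS Cmx_kernel_last.
Qed.

(** On the kernel of C(F) the multiplier term vanishes and the form of
    Pi_N^T X_N(P,1) Pi_N is that of the Lyapunov difference at the first
    state. Evaluating at kernel vectors gives one direction, Finsler's
    lemma the other. *)
Lemma lyapunov_LMI P : P^T = P ->
  negdefmx ((A_LTI A B C F)^T *m P *m A_LTI A B C F - P) <->
  exists M, negdefmx ((Pimx N A B)^T *m Xmx N P 1 *m Pimx N A B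
                      + He (M *m Cmx A B C F)).
Proof.
move=> sP; split=> [[_ nD]|[M [_ nD]]].
  apply: finsler => [|v Cv v0].
    by rewrite !trmx_mul trmxK Xmx_sym // mulmxA.
  rewrite qform_Cmx_kernel //; apply: nD; apply: contra v0 => /eqP xi0.
  exact/eqP/Cmx_kernel_eq0.
split=> [|w w0]; first by rewrite linearB /= !trmx_mul trmxK sP mulmxA.
have [v [Cv vw]] := Cmx_kernel_exists w.
have v0 : v != 0.
  by apply: contra w0 => /eqP v0; rewrite -vw v0 linear0 blk0.
have := nD v v0; rewrite -!/(qform _ _) qformD qform_He.
rewrite qform_Cmx_kernel // vw.
rewrite [qform (M *m _) v]/qform -!mulmxA Cv !mulmx0 mxE mulr0 addr0.
by rewrite /qform !mulmxA.
Qed.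

End Lifting.

Theorem theorem1 (R : realType) (N n m p : nat)
    (hN : (0 < N)%N) (hn : (0 < n)%N) (hm : (0 < m)%N) (hp : (0 < p)%N)
    (A : 'M[R]_n) (B : 'M[R]_(n, m)) (C : 'M[R]_(p, n)) :
  (forall F : 'M[R]_(N * m, N * p), structured F ->
     (forall x, periodic_system A B C F x ->
        lti_system (A_LTI A B C F) (fun t => x (N * t)%N)) /\
     (asymptotically_stable (periodic_system A B C F) <->
      asymptotically_stable (lti_system (A_LTI A B C F)))) /\
  ((exists F : 'M[R]_(N * m, N * p),
      structured F /\ asymptotically_stable (periodic_system A B C F)) <->
   (exists (P : 'M[R]_n) (M : 'M[R]_(N * n + N * m, N * m + N.-1 * n))
           (F : 'M[R]_(N * m, N * p)),
      [/\ P^T = P, structured F, posdefmx P &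
          negdefmx ((Pimx N A B)^T *m Xmx N P 1 *m Pimx N A B
                    + He (M *m Cmx A B C F))])).
Proof.
split=> [F _|].
  by split; [exact: periodic_sample | exact: periodic_stableP].
case: N hN => // h _.
split=> [[F [sF /(periodic_stableP (ltn0Sn h))[_ attr]]]|[P [M [F [sP sF pP LMI]]]]].
  have [P [pP nD]] := attractive_lyapunov attr; have [sP _] := pP.
  have [M LMI] := (proj1 (lyapunov_LMI A B C sF sP)) nD.
  by exists P, M, F; split.
exists F; split=> //; apply/(periodic_stableP (ltn0Sn h)).
apply: (lyapunov_stable pP); apply/(lyapunov_LMI A B C sF sP).
by exists M.
Qed.
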